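(* Let $G$ be a topological group which is locally $k_\omega$. Then $G$ is Weil complete.
   Context: A $k_\omega$-space is a Hausdorff topological space $X$ for which there is an ascending sequence $K_1\subseteq K_2\subseteq\cdots$ of compact subsets $K_n\subseteq X$ with $\bigcup_{n\in\mathbb{N}}K_n=X$ such that $X$ carries the direct limit topology, i.e., a subset $A\subseteq X$ is closed if and only if $A\cap K_n$ is closed in $K_n$ for each $n\in\mathbb{N}$. A Hausdorff topological space $X$ is called locally $k_\omega$ if each $x\in X$ has an open neighbourhood $U\subseteq X$ which is a $k_\omega$-space in the induced topology. A topological group is called locally $k_\omega$ if its underlying topological space is locally $k_\omega$. A topological group is called Weil complete if it is complete in its left uniformity, i.e., every Cauchy net (or Cauchy filter) with respect to the left uniform structure converges. *)

(* Defs.v *)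
From HB Require Import structures.
From mathcomp Require Import all_boot all_order all_algebra.
From mathcomp Require Import all_classical.
From mathcomp Require Import topology.

Set Implicit Arguments.
Unset Strict Implicit.
Unset Printing Implicit Defensive.

Local Open Scope classical_set_scope.
Local Open Scope group_scope.

HB.mixin Record isTopologicalGroup G & Topological G & Group G := {
  mulg_continuous : continuous (fun x : G * G => x.1 * x.2) ;
  invg_continuous : continuous (fun x : G => x^-1)
}.

#[short(type="topologicalGroupType")]
HB.structure Definition TopologicalGroup :=
  {G of Topological G & Group G & isTopologicalGroup G}.

(* [closed (set_val @^-1` A : set (K n))] says that A `&` K n is closed in K n:
   K n is coerced to the type [set_type (K n)], which carries the induced
   topology. *)
Definition k_omega_space (X : topologicalType) : Prop :=
  hausdorff_space X /\
  exists K : nat -> set X,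
    [/\ forall n, compact (K n),
        forall n, K n `<=` K n.+1,
        \bigcup_n K n = [set: X] &
        forall A : set X,
          closed A <-> forall n, closed (set_val @^-1` A : set (K n))].

Definition locally_k_omega (X : topologicalType) : Prop :=
  hausdorff_space X /\
  forall x : X, exists U : set X,
    [/\ open U, U x & k_omega_space (set_type U)].

Definition left_entourage (G : topologicalGroupType) : set_system (G * G) :=
  filter_from (nbhs (1 : G)) (fun U => [set xy | U (xy.1^-1 * xy.2)]).

(* A copy of G carrying the left uniformity, compatible with the topology
   of G. *)
Definition left_uniform (G : topologicalGroupType) : Type := G.

Section left_uniformity.
Variable G : topologicalGroupType.

HB.instance Definition _ := Topological.on (left_uniform G).

Lemma mulgl_continuous (x : G) : continuous (fun y : G => x * y).
Proof.
move=> y; apply: (@continuous_comp _ _ _ (fun y => (x, y))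
  (fun z : G * G => z.1 * z.2)); last exact: mulg_continuous.
by apply: cvg_pair => /=; [exact: cvg_cst|exact: cvg_id].
Qed.

Lemma left_entourage_filter : Filter (@left_entourage G).
Proof.
apply: filter_from_filter; first by exists setT; exact: filterT.
move=> U V nU nV; exists (U `&` V); first exact: filterI.
by move=> xy [].
Qed.

Lemma left_entourage_diagonal (A : set (G * G)) :
  left_entourage A -> diagonal `<=` A.
Proof.
move=> [U nU UA] [x y] /diagonalP ->; apply: UA => /=.
by rewrite mulVg; exact: nbhs_singleton.
Qed.

Lemma left_entourage_inv (A : set (G * G)) :
  left_entourage A -> left_entourage A^-1%relation.
Proof.
move=> [U nU UA]; exists [set x | U x^-1].
  by apply: (@invg_continuous G 1); rewrite /= invg1.
by move=> [x y] /= Uxy; apply: UA => /=; rewrite invgM invgK in Uxy.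
Qed.

Lemma left_entourage_split (A : set (G * G)) :
  left_entourage A -> exists2 B, left_entourage B & (B \; B)%relation `<=` A.
Proof.
move=> [U nU UA].
have : nbhs ((1, 1) : G * G) (fun z : G * G => U (z.1 * z.2)).
  by apply: (@mulg_continuous G (1, 1)); rewrite /= mul1g.
case=> -[V W] /= [nV nW] VWU.
exists [set xy | (V `&` W) (xy.1^-1 * xy.2)].
  by exists (V `&` W) => //; exact: filterI.
move=> [x z] [y /= [Vxy _] [_ Wyz]]; apply: UA => /=.
by have := VWU (x^-1 * y, y^-1 * z) (conj Vxy Wyz); rewrite /= mulgA mulgK.
Qed.

Lemma nbhs_left_entourage :
  @nbhs (left_uniform G) (left_uniform G) = nbhs_ (@left_entourage G).
Proof.
apply/funext => x; apply/seteqP; split => A.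
  move=> nA; exists [set xy | A (x * (xy.1^-1 * xy.2))].
    exists [set y | A (x * y)] => //.
    by apply: (@mulgl_continuous x 1); rewrite mulg1.
  by move=> y /xsectionP /=; rewrite mulVKg.
move=> [B [U nU UB] BA].
have : nbhs (x : G) [set y | U (x^-1 * y)].
  by apply: (@mulgl_continuous x^-1 x); rewrite mulVg.
by apply: filterS => y Uy; apply: BA; apply/xsectionP; exact: UB.
Qed.

HB.instance Definition _ := Nbhs_isUniform.Build (left_uniform G)
  left_entourage_filter left_entourage_diagonal left_entourage_inv
  left_entourage_split nbhs_left_entourage.

End left_uniformity.

Definition Weil_complete (G : topologicalGroupType) : Prop :=
  forall F : set_system (left_uniform G),
    ProperFilter F -> cauchy F -> exists x : left_uniform G, F --> x.

(* Main.v *)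
Require Import Defs.
From mathcomp Require Import all_boot all_order all_algebra.
From mathcomp Require Import all_classical.
From mathcomp Require Import topology.

(** Let [U] be an open k_omega neighbourhood of [1], exhausted by compact sets
    [L 0], [L 1], ..., and suppose that a Cauchy filter [F] does not converge.
    Being Cauchy, [F] then has no cluster point, so every compact set [D] has a
    uniform neighbourhood [D V] whose complement belongs to [F], with [V] an
    open neighbourhood of [1] ([no_cluster_compact_avoid]).

    The essential point is that in a k_omega space an infinite intersection of
    open sets [O n] containing the [n]-th compact set is still open: on a fixed
    compact set of the exhaustion only finitely many [O n] matter
    ([exhaustion_bigcap_open]).  Hence, if [C n] is [L n] together with [1],
    then for any open neighbourhoods [V n] of [1] the set
    [W = U `&` \bigcap_n C n V n] is a neighbourhood of [1].

    After choosing [a0] such that [a0 U] belongs to [F], take [V n] such that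
    [F] avoids [a0 (L n) (C n) (V n)].  Some member [A] of [F] is contained in
    [a0 U] and satisfies [A^-1 A `<=` W].  Any [a] in [A] lies in [a0 (L m)]
    for some [m], so [A `<=` a W `<=` a0 (L m) (C m) (V m)], which contradicts
    the choice of [V m]. *)

Set Implicit Arguments.
Unset Strict Implicit.
Unset Printing Implicit Defensive.

Local Open Scope classical_set_scope.
Local Open Scope group_scope.

Lemma exhaustion_bigcap_open (X : topologicalType) (K O : nat -> set X) :
  (forall n, K n `<=` K n.+1) ->
  (forall A : set X,
     closed A <-> forall n, closed (set_val @^-1` A : set (K n))) ->
  (forall n, open (O n)) -> (forall n, K n `<=` O n) ->
  open (\bigcap_n O n).
Proof.
move=> Kincr Klim Oopen KO.
have Kmono : {homo K : m n / (m <= n)%N >-> m `<=` n}.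
  by apply: homo_leq => //; [move=> A|move=> B A C; exact: subset_trans].
rewrite -[\bigcap_n O n]setCK openC setC_bigcap; apply/Klim => j.
(* On [K j] the sets [O n] with [j <= n] impose no condition. *)
have -> : set_val @^-1` (\bigcup_n ~` O n) =
    (set_val @^-1` (\bigcup_(n in `I_j) ~` O n) : set (K j)).
  apply/seteqP; split => x [n In nOx]; exists n => //=.
  rewrite ltnNge; apply/negP => jn; apply: nOx; apply/KO/(Kmono _ _ jn).
  exact: set_valP.
apply: closed_comp; first by move=> x _; exact: initial_continuous.
apply: closed_bigcup; first exact: finite_II.
by move=> n _; rewrite closedC.
Qed.

Lemma open_k_omega_exhaustion (T : topologicalType) (U : set T) :
  open U -> k_omega_space (set_type U) ->
  exists L : nat -> set T,
    [/\ forall n, compact (L n),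
        \bigcup_n L n = U &
        forall O : nat -> set T, (forall n, open (O n)) ->
          (forall n, L n `<=` O n) -> open (U `&` \bigcap_n O n)].
Proof.
move=> Uopen [_ [K [Kcpt Kincr Kcover Klim]]].
exists (fun n => set_val @` K n); split.
- move=> n; apply: continuous_compact => //.
  exact/continuous_subspaceT/initial_continuous.
- apply/seteqP; split => [x [n _ [y _ <-]]|x Ux]; first exact: set_valP.
  have : [set: set_type U] (SigSub (mem_set Ux)) by [].
  by rewrite -Kcover => -[n _ Kx]; exists n => //; exists (SigSub (mem_set Ux)).
- move=> O Oopen LO.
  have : open (\bigcap_n (set_val @^-1` O n) : set (set_type U)).
    apply: (exhaustion_bigcap_open Kincr Klim) => n.
      by apply: open_comp => // x _; exact: initial_continuous.
    by move=> x Kx; apply: LO; exists x.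
  move=> [B Bopen BO].
  suff -> : U `&` \bigcap_n O n = U `&` B by exact: openI.
  apply/seteqP; split => x [Ux xB]; split => //.
    suff : (set_val @^-1` B) (SigSub (mem_set Ux) : set_type U) by [].
    by rewrite BO => n _; exact: xB.
  have : (set_val @^-1` B) (SigSub (mem_set Ux) : set_type U) by [].
  by rewrite BO.
Qed.

Lemma cauchy_cluster_cvg (T : uniformType) (F : set_system T) (x : T) :
  Filter F -> cauchy F -> cluster F x -> F --> x.
Proof.
move=> FF Fc clx A; rewrite -nbhs_entourageE => -[E entE EA].
have [[P Q] /= [FP FQ] PQ] := Fc _ (entourage_split_ent entE).
have nx : nbhs x (xsection (split_ent E) x).
  exact: nbhs_entourage (entourage_split_ent entE).
have [p [Pp /xsectionP xp]] := clx _ _ FP nx.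
apply: filterS FQ => q Qq; apply/EA/xsectionP.
exact: entourage_split xp (PQ (p, q) (conj Pp Qq)).
Qed.

Section topological_group.
Variable G : topologicalGroupType.

(** A filter clustering at no point of a compact set [D] avoids [D V] for some
    open neighbourhood [V] of the unit. *)
Lemma no_cluster_compact_avoid (F : set_system G) (D : set G) :
  Filter F -> compact D -> (forall x, D x -> ~ cluster F x) ->
  exists V : set G, [/\ open V, V 1 &
    F [set b | forall d, D d -> ~ V (d^-1 * b)]].
Proof.
move=> FF /compact_near_coveringP Dcov nclF.
have /= := Dcov _ (filter_prod (nbhs (1 : G)) F)
  (fun vb x => x * vb.1 <> vb.2) _.
case.
  move=> x Dx.
  have /existsNP[A /existsNP[B /not_implyP[FA /not_implyP[nB AB]]]] := nclF x Dx.
  have : nbhs ((x, 1) : G * G) [set z | B (z.1 * z.2)].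
    by apply: (@mulg_continuous G (x, 1)); rewrite /= mulg1.
  case=> -[P Q] /= [nP nQ] PQB.
  exists (P, Q `*` A) => /=; first by split=> //; exists (Q, A).
  move=> [y [v b]] /= [Py [Qv Ab]] yvb; apply: AB; exists b; split=> //.
  by rewrite -yvb; exact: (PQB (y, v)).
move=> [P Q] /= [nP FQ] PQ; exists P^°; split.
- exact: open_interior.
- exact: nP.
- apply: filterS FQ => b Qb d Dd /interior_subset Pdb.
  by apply: (PQ (d^-1 * b, b) _ d Dd) => //=; rewrite mulVKg.
Qed.

Lemma compact_translate_mul (a : G) (A B : set G) :
  compact A -> compact B ->
  compact ((fun z : G * G => a * (z.1 * z.2)) @` (A `*` B)).
Proof.
move=> cA cB; apply: continuous_compact; last exact: compact_setX.
apply: continuous_subspaceT => z.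
apply: (@continuous_comp _ _ _ (fun z : G * G => z.1 * z.2) (fun y => a * y)).
  exact: mulg_continuous.
exact: mulgl_continuous.
Qed.

Lemma open_set_mul (C V : set G) :
  open V -> open [set y | exists2 c, C c & V (c^-1 * y)].
Proof.
move=> Vopen; rewrite openE => y [c Cc Vcy].
have : nbhs y [set z | V (c^-1 * z)].
  by apply: mulgl_continuous; exact: open_nbhs_nbhs.
by apply: filterS => z Vz; exists c.
Qed.

End topological_group.

Theorem proposition1p1 (G : topologicalGroupType) (hG : locally_k_omega G) :
  Weil_complete G.
Proof.
move=> F FF Fc; apply: contrapT => /forallNP nconv.
have nclF x : ~ cluster (F : set_system G) x.
  by move=> clx; apply: (nconv x); exact: cauchy_cluster_cvg Fc clx.
have Fsmall (W : set G) : nbhs (1 : G) W ->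
    exists2 A : set G, F A & forall a b, A a -> A b -> W (a^-1 * b).
  move=> nW.
  have [|[P Q] /= [FP FQ] PQ] := Fc [set xy : G * G | W (xy.1^-1 * xy.2)].
    by exists W.
  exists (P `&` Q); first exact: filterI.
  by move=> a b [Pa _] [_ Qb]; exact: (PQ (a, b)).
have [_ /(_ 1)[U [Uopen U1 Uk]]] := hG.
have [L [Lcpt LU Lopen]] := open_k_omega_exhaustion Uopen Uk.
have [A0 FA0 A0U] := Fsmall U (open_nbhs_nbhs (conj Uopen U1)).
have [a0 A0a0] := filter_ex FA0.
pose C n := L n `|` [set 1 : G].
have Ccpt n : compact (C n) by apply: compactU => //; exact: compact_set1.
pose D n := (fun z : G * G => a0 * (z.1 * z.2)) @` (L n `*` C n).
have /choice[V HV] n : exists V : set G, [/\ open V, V 1 &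
    F [set b | forall d, D n d -> ~ V (d^-1 * b)]].
  apply: no_cluster_compact_avoid => //.
  exact: compact_translate_mul.
pose O n := [set y | exists2 c, C n c & V n (c^-1 * y)].
have Wopen : open (U `&` \bigcap_n O n).
  apply: Lopen => n; have [Vo V1 _] := HV n; first exact: open_set_mul.
  by move=> x Lx; exists x; [left|rewrite mulVg].
have W1 : (U `&` \bigcap_n O n) 1.
  split=> // n _; have [_ V1 _] := HV n.
  by exists 1; [right|rewrite mulVg].
have [A FA AW] := Fsmall _ (open_nbhs_nbhs (conj Wopen W1)).
have [a [Aa A0a]] := filter_ex (filterI FA FA0).
have := A0U _ _ A0a0 A0a; rewrite -LU => -[m _ Lm].
have [_ _ Favoid] := HV m.
have [b [Ab avb]] := filter_ex (filterI FA Favoid).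
have [_ /(_ m I)[c Cc Vc]] := AW _ _ Aa Ab.
apply: (avb (a * c)); last by rewrite invgM -mulgA.
by exists (a0^-1 * a, c) => //=; rewrite !mulgA mulgV mul1g.
Qed.
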